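(* Let $X\in\mathbb R^{m\times n}$ have no zero rows, let $\Psi$ be its row-normalization, $\Gamma(X)=\Psi\Psi^\top$, and suppose that $\Gamma(X)\succ0$. Let $\mathcal A:=\{i:\lambda_i>1\}$ and $\Delta_{\mathcal A}:=\widetilde U_{\mathcal A}(\Lambda_{\mathcal A}^{-1/2}-I)\widetilde U_{\mathcal A}^\top$. Let $r$ be a rank budget, and consider, over matrices $\Delta\in\mathbb R^{m\times m}$, the problem $$\Delta^\star\in\arg\min_{\operatorname{rank}(\Delta)\le r}\frac12\left\|(\Delta-\Delta_{\mathcal A})\Psi\right\|_F^2 .$$ Let $\mathcal C\subseteq\mathcal A$ index the $\min\{r,|\mathcal A|\}$ largest eigenvalues satisfying $\lambda_i>1$. Then one solution is $$\Delta^\star=\widetilde U_{\mathcal C}\left(\Lambda_{\mathcal C}^{-1/2}-I\right)\widetilde U_{\mathcal C}^\top .$$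
   Context: For $X\in\mathbb R^{m\times n}$ with rows $x_1^\top,\dots,x_m^\top$ all nonzero, $D(X):=\operatorname{Diag}(\|x_1\|_2,\dots,\|x_m\|_2)$, $\Psi:=D(X)^{-1}X$ and $\Gamma(X):=\Psi\Psi^\top$. Let $\Psi=\widetilde U\widetilde\Sigma\widetilde V^\top$ be a thin SVD with singular values $\widetilde\sigma_1\ge\dots\ge\widetilde\sigma_m\ge0$, so that $\Gamma(X)=\widetilde U\Lambda\widetilde U^\top$ with $\Lambda=\operatorname{Diag}(\lambda_1,\dots,\lambda_m)$ and $\lambda_i=\widetilde\sigma_i^2$. For an index set $\mathcal S$, $\widetilde U_{\mathcal S}$ is the matrix of columns of $\widetilde U$ indexed by $\mathcal S$ and $\Lambda_{\mathcal S}:=\operatorname{Diag}(\lambda_i)_{i\in\mathcal S}$. The matrix $\Delta_{\mathcal A}$ equals $P_+-I_m$, where $P_+=I_m+\widetilde U_{\mathcal A}(\Lambda_{\mathcal A}^{-1/2}-I)\widetilde U_{\mathcal A}^\top$ is the preconditioner for which $P_+\Psi$ is the Frobenius-nearest matrix to $\Psi$ in the unit spectral-norm ball. The resulting preconditioner and update are defined as $P:=I_m+\Delta^\star$ and $T:=P\Psi$. *)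

(* Defs.v *)
From mathcomp Require Import all_boot all_order all_algebra.
From mathcomp Require Import reals.

Set Implicit Arguments.
Unset Strict Implicit.
Unset Printing Implicit Defensive.

Import Order.TTheory GRing.Theory Num.Theory.
Local Open Scope ring_scope.

Section Defs.
Variable R : realType.

Definition l2norm n (v : 'rV[R]_n) : R := Num.sqrt (\sum_j v 0 j ^+ 2).

(* MathComp-Analysis's norm on matrices is the max norm, hence this one. *)
Definition frobenius m n (A : 'M[R]_(m, n)) : R :=
  Num.sqrt (\sum_i \sum_j A i j ^+ 2).

Definition posdefmx m (A : 'M[R]_m) : Prop :=
  A^T = A /\ forall v : 'cV[R]_m, v != 0 -> 0 < (v^T *m A *m v) 0 0.

Definition row_norms m n (X : 'M[R]_(m, n)) : 'M[R]_m :=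
  diag_mx (\row_i l2norm (row i X)).

(* invmx is a true inverse only when X has no zero row. *)
Definition row_normalize m n (X : 'M[R]_(m, n)) : 'M[R]_(m, n) :=
  invmx (row_norms X) *m X.

Definition row_gram m n (X : 'M[R]_(m, n)) : 'M[R]_m :=
  row_normalize X *m (row_normalize X)^T.

(* The thin SVD with m singular values: U is m x m, V is n x m.  It requires
   m <= n, which holds when A *m A^T is positive definite. *)
Definition thin_svd m n (A : 'M[R]_(m, n))
    (U : 'M[R]_m) (sigma : 'rV[R]_m) (V : 'M[R]_(n, m)) : Prop :=
  [/\ U^T *m U = 1%:M,
      V^T *m V = 1%:M,
      forall i j : 'I_m, (i <= j)%N -> sigma 0 j <= sigma 0 i,
      forall i, 0 <= sigma 0 i
    & A = U *m diag_mx sigma *m V^T].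

Definition sq_entries m (sigma : 'rV[R]_m) : 'rV[R]_m :=
  \row_i sigma 0 i ^+ 2.

Definition col_select m k (S : {set 'I_k}) (U : 'M[R]_(m, k)) :
    'M[R]_(m, #|S|) :=
  colsub (fun j : 'I_#|S| => enum_val j) U.

(* Lambda_S^{-1/2}, where Lambda is the diagonal matrix with diagonal lambda. *)
Definition diag_select_invsqrt m (S : {set 'I_m}) (lambda : 'rV[R]_m) :
    'M[R]_#|S| :=
  diag_mx (\row_(j < #|S|) (Num.sqrt (lambda 0 (enum_val j)))^-1).

Definition spectral_correction m (S : {set 'I_m})
    (U : 'M[R]_m) (lambda : 'rV[R]_m) : 'M[R]_m :=
  col_select S U *m (diag_select_invsqrt S lambda - 1%:M)
    *m (col_select S U)^T.

Definition above_one m (lambda : 'rV[R]_m) : {set 'I_m} :=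
  [set i | 1 < lambda 0 i].

(* C indexes k largest values of lambda over A; when there are ties C is not
   unique and every valid choice is admitted. *)
Definition indexes_largest m (lambda : 'rV[R]_m) (A : {set 'I_m}) (k : nat)
    (C : {set 'I_m}) : Prop :=
  [/\ C \subset A, #|C| = k
    & forall i j, i \in C -> j \in A :\: C -> lambda 0 j <= lambda 0 i].

Definition is_argmin (T : Type) (feasible : T -> Prop) (f : T -> R) (x : T) :
    Prop :=
  feasible x /\ forall y, feasible y -> f x <= f y.

End Defs.

(* Main.v *)
Require Import Defs.
From mathcomp Require Import all_boot all_order all_algebra.
From mathcomp Require Import reals.

Set Implicit Arguments.
Unset Strict Implicit.
Unset Printing Implicit Defensive.

Import Order.TTheory GRing.Theory Num.Theory.
Local Open Scope ring_scope.

(** By orthogonal invariance of the Frobenius norm, the objective at [Delta] is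
    half the squared distance from [E := U^T Delta U Sigma], of rank at most
    [r], to the diagonal matrix with entries [1 - sigma_i] on [A] and 0
    elsewhere.  So this is Eckart-Young for a diagonal target [diag d]: if [P]
    is the orthogonal projector onto the kernel of [E], then
    [|E - diag d|^2 >= |(E - diag d) P|^2 = \sum_i d_i^2 P_ii], where
    [0 <= P_ii <= 1] and [\tr P >= m - r]; the minimum of this linear form
    puts the missing weight on the [r] largest [d_i^2]. *)

Section FrobeniusSquare.
Variable R : realType.

Lemma mxtrace_mulmx_tr m n (A : 'M[R]_(m, n)) :
  \tr (A *m A^T) = \sum_i \sum_j A i j ^+ 2.
Proof.
by apply: eq_bigr => i _; rewrite mxE; apply: eq_bigr => j _; rewrite mxE expr2.
Qed.

Lemma mxtrace_mulmx_tr_ge0 m n (A : 'M[R]_(m, n)) : 0 <= \tr (A *m A^T).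
Proof.
by rewrite mxtrace_mulmx_tr; do 2![apply: sumr_ge0 => ? _]; apply: sqr_ge0.
Qed.

Lemma sqr_frobenius m n (A : 'M[R]_(m, n)) :
  frobenius A ^+ 2 = \tr (A *m A^T).
Proof. by rewrite sqr_sqrtr -mxtrace_mulmx_tr ?mxtrace_mulmx_tr_ge0. Qed.

Lemma mulmx_tr_eq0 m n (A : 'M[R]_(m, n)) : A *m A^T = 0 -> A = 0.
Proof.
move=> A0; have /eqP := mxtrace_mulmx_tr A.
rewrite A0 mxtrace0 eq_sym psumr_eq0 => [/allP s0|i _]; last first.
  by apply: sumr_ge0 => j _; apply: sqr_ge0.
apply/matrixP => i j; rewrite mxE; apply/eqP; rewrite -sqrf_eq0.
have /(_ i (mem_index_enum i)) := s0.
rewrite psumr_eq0 => [/allP/(_ j (mem_index_enum j))//|k _].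
exact: sqr_ge0.
Qed.

Lemma sqr_frobenius_mul_orth m n p (U : 'M[R]_m) (V : 'M[R]_(n, p))
    (A : 'M[R]_(m, p)) :
  U^T *m U = 1%:M -> V^T *m V = 1%:M ->
  frobenius (U *m A *m V^T) ^+ 2 = frobenius A ^+ 2.
Proof.
move=> UU VV; rewrite !sqr_frobenius !trmx_mul trmxK !mulmxA.
rewrite -(mulmxA _ V^T V) VV mulmx1 mxtrace_mulC -!mulmxA.
by rewrite !mulmxA UU mul1mx.
Qed.

Lemma sqr_frobenius_diag m (d : 'rV[R]_m) :
  frobenius (diag_mx d) ^+ 2 = \sum_i d 0 i ^+ 2.
Proof.
rewrite sqr_frobenius tr_diag_mx mulmx_diag mxtrace_diag.
by apply: eq_bigr => i _; rewrite mxE expr2.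
Qed.

End FrobeniusSquare.

Section OrthogonalProjector.
Variables (R : realType) (m : nat) (P : 'M[R]_m).
Hypotheses (P_sym : P^T = P) (P_idem : P *m P = P).

Lemma proj_diag_ge0 i : 0 <= P i i.
Proof.
rewrite -[in P i i]P_idem mxE; apply: sumr_ge0 => j _.
by rewrite -[in P j i]P_sym mxE -expr2 sqr_ge0.
Qed.

Lemma compl_proj_sym : (1%:M - P)^T = 1%:M - P.
Proof. by rewrite linearB /= trmx1 P_sym. Qed.

Lemma compl_proj_idem : (1%:M - P) *m (1%:M - P) = 1%:M - P.
Proof. by rewrite mulmxBl mul1mx mulmxBr mulmx1 P_idem subrr subr0. Qed.

Lemma sqr_frobenius_mul_proj n (M : 'M[R]_(n, m)) :
  frobenius (M *m P) ^+ 2 = \tr (M *m P *m M^T).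
Proof.
by rewrite sqr_frobenius trmx_mul P_sym !mulmxA -(mulmxA M P) P_idem.
Qed.

End OrthogonalProjector.

Lemma proj_diag_le1 (R : realType) m (P : 'M[R]_m) i :
  P^T = P -> P *m P = P -> P i i <= 1.
Proof.
move=> Ps Pi.
have := proj_diag_ge0 (compl_proj_sym Ps) (compl_proj_idem Pi) i.
by rewrite !mxE eqxx subr_ge0.
Qed.

(** Pythagoras: the gap between the two sides is the squared norm of [M *m (1%:M - P)], since
    [1%:M - P] is again an orthogonal projector. *)
Lemma sqr_frobenius_mul_proj_le (R : realType) n m (P : 'M[R]_m)
    (M : 'M[R]_(n, m)) :
  P^T = P -> P *m P = P -> frobenius (M *m P) ^+ 2 <= frobenius M ^+ 2.
Proof.
move=> Ps Pi; rewrite -subr_ge0.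
suff -> : frobenius M ^+ 2 - frobenius (M *m P) ^+ 2
    = frobenius (M *m (1%:M - P)) ^+ 2 by apply: sqr_ge0.
rewrite !sqr_frobenius_mul_proj ?compl_proj_sym ?compl_proj_idem //.
by rewrite sqr_frobenius mulmxBr mulmx1 mulmxBl linearB.
Qed.

(** If [L] kills the Gram matrix on the left, then [(L *m K) *m (L *m K)^T = 0], so [L *m K = 0]
    over the reals, and row freeness gives [L = 0]. *)
Lemma gram_unitmx (R : realType) p m (K : 'M[R]_(p, m)) :
  row_free K -> K *m K^T \in unitmx.
Proof.
move=> Kfree; rewrite -row_free_unit -kermx_eq0; apply/eqP.
set L := kermx (K *m K^T).
have LG : L *m (K *m K^T) = 0 by apply: mulmx_ker.
apply: (row_free_inj Kfree); rewrite mul0mx; apply: mulmx_tr_eq0.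
by rewrite trmx_mul !mulmxA -(mulmxA L K) LG mul0mx.
Qed.

Lemma kernel_proj (R : realType) n m (E : 'M[R]_(n, m)) :
  exists P : 'M[R]_m,
    [/\ P^T = P, P *m P = P, E *m P = 0 & \tr P = (m - \rank E)%:R].
Proof.
set K := row_base (kermx E^T).
have Kfree : row_free K by apply: row_base_free.
have EK : E *m K^T = 0.
  apply: trmx_inj; rewrite trmx_mul trmxK trmx0.
  by apply/sub_kermxP; rewrite eq_row_base.
have G_unit : K *m K^T \in unitmx by apply: gram_unitmx.
clearbody K.
(* The rows of [K] form a basis of the kernel of [E], and this is the usual formula for the
   orthogonal projector onto their span. Cycling the trace turns it into that of an identity matrix
   whose size is the dimension of the kernel. *)
exists (K^T *m invmx (K *m K^T) *m K); split.
- by rewrite !trmx_mul trmxK trmx_inv trmx_mul trmxK mulmxA.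
- by rewrite !mulmxA -(mulmxA _ K K^T) mulmxKV.
- by rewrite !mulmxA EK !mul0mx.
- by rewrite mxtrace_mulC mulmxA mulmxV // mxtrace1 mxrank_ker mxrank_tr.
Qed.

Lemma weighted_sum_ge (R : realType) m (f w : 'I_m -> R) (C : {set 'I_m}) :
  (forall i, 0 <= f i) -> (forall i, 0 <= w i <= 1) ->
  (forall i j, i \in C -> j \notin C -> f j <= f i) ->
  (m - #|C|)%:R <= \sum_i w i ->
  \sum_(i in ~: C) f i <= \sum_i f i * w i.
Proof.
move=> f0 w01 fC ws.
(* [t] is a threshold between the values of [f] off [C] and those on [C], even
   when [C] or its complement is empty. *)
pose t := \big[Order.max/0]_(j in ~: C) f j.
have t0 : 0 <= t by apply: bigmax_ge_id.
(* Equivalent to [(f i - t) * (w i - (i \notin C)%:R) >= 0]: both factors are nonnegative on [C] and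
   nonpositive off [C]. *)
have fact i : (i \notin C)%:R * f i + t * (w i - (i \notin C)%:R) <= f i * w i.
  have /andP[w0 w1] := w01 i.
  case: (boolP (i \in C)) => iC /=.
    rewrite mul0r add0r subr0 ler_wpM2r //.
    by apply/bigmax_leP; split=> // j; rewrite inE; apply: fC.
  have ft : f i <= t by apply: le_bigmax_cond; rewrite inE.
  rewrite mul1r -lerBrDl -[X in _ <= _ - X]mulr1 -mulrBr.
  by rewrite ler_wnM2r // subr_le0.
have -> : \sum_(i in ~: C) f i = \sum_i (i \notin C)%:R * f i.
  rewrite big_mkcond; apply: eq_bigr => i _; rewrite inE.
  by case: (i \in C); rewrite ?mul0r ?mul1r.
apply: le_trans (ler_sum _ (fun i _ => fact i)).
(* After summation the surplus is [t] times the excess of the total weight over the cardinality of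
   the complement of [C]. *)
rewrite big_split /= -mulr_sumr lerDl mulr_ge0 // sumrB subr_ge0.
apply: le_trans ws; rewrite -natr_sum ler_nat.
have := cardsC C; rewrite card_ord => /(canRL (addKn _)) <-.
rewrite -sum1_card [X in (_ <= X)%N]big_mkcond.
by apply: leq_sum => i _; rewrite inE; case: (i \in C).
Qed.

Lemma eckart_young_diag (R : realType) m (E : 'M[R]_m) (d : 'rV[R]_m)
    (C : {set 'I_m}) :
  (forall i j, i \in C -> j \notin C -> d 0 j ^+ 2 <= d 0 i ^+ 2) ->
  (\rank E <= #|C|)%N ->
  \sum_(i in ~: C) d 0 i ^+ 2 <= frobenius (E - diag_mx d) ^+ 2.
Proof.
move=> dC rE; have [P [Ps Pi EP trP]] := kernel_proj E.
apply: le_trans (sqr_frobenius_mul_proj_le _ Ps Pi).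
have -> : frobenius ((E - diag_mx d) *m P) ^+ 2 = \sum_i d 0 i ^+ 2 * P i i.
  rewrite mulmxBl EP sub0r -mulNmx sqr_frobenius_mul_proj //.
  rewrite mulNmx linearN /= mulmxN mulNmx opprK tr_diag_mx.
  apply: eq_bigr => i _.
  by rewrite mul_mx_diag mxE mul_diag_mx mxE mulrAC expr2.
apply: weighted_sum_ge => // [i|i|]; first exact: sqr_ge0.
  by rewrite proj_diag_ge0 ?proj_diag_le1.
by rewrite -/(\tr P) trP ler_nat leq_sub2l.
Qed.

(** The spectrum of the correction, padded with zeros off [S], so that corrections for different
    sets are diagonal in the same basis [U]. *)
Definition correction_diag (R : realType) m (S : {set 'I_m})
    (lambda : 'rV[R]_m) : 'rV[R]_m :=
  \row_i (if i \in S then (Num.sqrt (lambda 0 i))^-1 - 1 else 0).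

Lemma spectral_correctionE (R : realType) m (S : {set 'I_m}) (U : 'M[R]_m)
    (lambda : 'rV[R]_m) :
  spectral_correction S U lambda
  = U *m diag_mx (correction_diag S lambda) *m U^T.
Proof.
apply/matrixP => i j; rewrite /spectral_correction /diag_select_invsqrt.
rewrite -diag_const_mx -linearB /= !mul_mx_diag !mxE.
pose g k := U i k * ((Num.sqrt (lambda 0 k))^-1 - 1) * U j k.
transitivity (\sum_(k in S) g k).
  by rewrite [RHS]big_enum_val; apply: eq_bigr => k _; rewrite !mxE.
rewrite [LHS]big_mkcond; apply: eq_bigr => k _; rewrite !mxE /g.
by case: ifP => // _; rewrite mulr0 mul0r.
Qed.

Lemma rank_spectral_correction (R : realType) m (S : {set 'I_m})
    (U : 'M[R]_m) (lambda : 'rV[R]_m) :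
  (\rank (spectral_correction S U lambda) <= #|S|)%N.
Proof.
rewrite /spectral_correction -mulmxA.
exact: leq_trans (mxrankM_maxl _ _) (rank_leq_col _).
Qed.

(** On [S] the singular value exceeds 1, hence is nonzero and cancels its inverse. *)
Lemma correction_diag_sq_entries (R : realType) m (sigma : 'rV[R]_m)
    (S : {set 'I_m}) i :
  (forall j, 0 <= sigma 0 j) -> S \subset above_one (sq_entries sigma) ->
  correction_diag S (sq_entries sigma) 0 i * sigma 0 i
  = if i \in S then 1 - sigma 0 i else 0.
Proof.
move=> s0 /subsetP SA; rewrite !mxE; case: ifP => [iS|_]; last by rewrite mul0r.
rewrite sqrtr_sqr ger0_norm // mulrBl mul1r mulVf //.
have := SA i iS; rewrite inE mxE; apply: contraTneq => ->.
by rewrite expr0n ltr10.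
Qed.

Theorem proposition2 (R : realType) (m n : nat) (X : 'M[R]_(m, n))
    (X_rows : forall i, row i X != 0)
    (Gamma_pos : posdefmx (row_gram X))
    (U : 'M[R]_m) (sigma : 'rV[R]_m) (V : 'M[R]_(n, m))
    (svd : thin_svd (row_normalize X) U sigma V)
    (r : nat) (C : {set 'I_m}) :
  let Psi := row_normalize X in
  let lambda := sq_entries sigma in
  let A := above_one lambda in
  let Delta_A := spectral_correction A U lambda in
  indexes_largest lambda A (minn r #|A|) C ->
  is_argmin (fun Delta : 'M[R]_m => (\rank Delta <= r)%N)
    (fun Delta => 2^-1 * frobenius ((Delta - Delta_A) *m Psi) ^+ 2)
    (spectral_correction C U lambda).
Proof.
move=> Psi lambda A Delta_A [CA cardC Cmax].
have [UU VV _ s0 PsiE] := svd.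
have UU' : U *m U^T = 1%:M by apply: mulmx1C.
pose d : 'rV[R]_m := \row_i (if i \in A then 1 - sigma 0 i else 0).
have corrE (S : {set 'I_m}) : S \subset A ->
    diag_mx (correction_diag S lambda) *m diag_mx sigma
    = diag_mx (\row_i (if i \in S then d 0 i else 0)).
  move=> SA; rewrite mulmx_diag; congr diag_mx; apply/rowP => i.
  rewrite mxE correction_diag_sq_entries // !mxE.
  by case: ifP => // /(subsetP SA) ->.
(* Passing to singular coordinates makes the target diagonal. *)
have obj Delta : frobenius ((Delta - Delta_A) *m Psi) ^+ 2
    = frobenius (U^T *m Delta *m U *m diag_mx sigma - diag_mx d) ^+ 2.
  have -> : diag_mx d = diag_mx (correction_diag A lambda) *m diag_mx sigma.
    rewrite corrE //; congr diag_mx; apply/rowP => i; rewrite !mxE.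
    by case: ifP.
  rewrite -[RHS](sqr_frobenius_mul_orth _ UU VV) /Psi PsiE.
  congr (frobenius _ ^+ 2).
  rewrite -mulmxBl !mulmxA; do 2![congr (_ *m _)].
  rewrite mulmxBr mulmxBl !mulmxA UU' mul1mx.
  rewrite /Delta_A spectral_correctionE.
  by rewrite -!mulmxA UU !mulmx1.
have objC : frobenius ((spectral_correction C U lambda - Delta_A) *m Psi) ^+ 2
    = \sum_(i in ~: C) d 0 i ^+ 2.
  rewrite obj spectral_correctionE !mulmxA UU mul1mx -(mulmxA _ U^T) UU mulmx1.
  rewrite corrE // -linearB sqr_frobenius_diag [RHS]big_mkcond.
  apply: eq_bigr => i _; rewrite !mxE in_setC.
  by case: (i \in C); rewrite /= ?subrr ?expr0n // sub0r sqrrN.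
split=> [|Delta rD].
  by apply: leq_trans (rank_spectral_correction _ _ _) _; rewrite cardC geq_minl.
rewrite ler_pM2l ?invr_gt0 ?ltr0n // objC.
(* If [r] exceeds the size of [A], a competitor may have rank above [#|C|], so the Eckart-Young
   bound does not apply; but then [C = A] and the objective vanishes at the candidate. *)
have [rA|Ar] := leqP r #|A|; last first.
  have -> : C = A.
    by apply/eqP; rewrite eqEcard CA cardC leq_min leqnn (ltnW Ar).
  rewrite big1 ?sqr_ge0 // => i; rewrite inE mxE => /negPf ->.
  by rewrite expr0n.
rewrite obj; apply: eckart_young_diag => [i j iC jC|]; last first.
  rewrite cardC (minn_idPl rA); apply: leq_trans rD.
  apply: leq_trans (mxrankM_maxl _ _) _.
  by apply: leq_trans (mxrankM_maxl _ _) _; apply: mxrankM_maxr.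
(* On [A] the entry [d] squares to [(sigma - 1) ^+ 2], which increases with [sigma] above 1, so the
   order of the eigenvalues is that of the weights; off [A] the weight is 0. *)
have gt1 k : k \in A -> 1 < sigma 0 k.
  by rewrite inE mxE expr_gt1.
have iA := subsetP CA i iC.
rewrite !mxE iA; case: ifP => jA; last by rewrite expr0n sqr_ge0.
have /Cmax : j \in A :\: C by rewrite inE jC jA.
move=> /(_ i iC); rewrite !mxE ler_pXn2r ?nnegrE // => sji.
rewrite -[X in X <= _]sqrrN -[X in _ <= X]sqrrN !opprB.
by rewrite ler_pXn2r ?nnegrE ?subr_ge0 ?lerB // ltW ?gt1.
Qed.
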